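(* Consider the predictor--corrector finite volume scheme for the one-dimensional nonlinear shallow water equations on a grid $\{x_j^n\}$ described in the context. Assume that the grid is fixed, but possibly non-uniform (so that $x_j^{n+1}=x_j^n$ and $x_{t,j}^n=0$ for all $j$). If on the $n$-th time layer one has the lake at rest state, i.e. $$\eta_j^n \equiv 0,\qquad v_j^n \equiv 0,$$ then the predictor--corrector scheme preserves this state at the $(n+1)$-th time layer, i.e. $$\eta_j^{n+1} \equiv 0,\qquad v_j^{n+1} \equiv 0.$$
   Context: **Unknowns and grid.** The nonlinear shallow water equations are considered on a finite segment $[0,\ell]$, $\ell>0$, with appropriate boundary conditions. Let $g>0$ be the gravity acceleration and $h:[0,\ell]\to\mathbb{R}$ the given time-independent bathymetry function. Let $\Delta q=1/N$ and let $\tau>0$ be the time step. On each time layer $n$ there are grid nodes $0=x_0^n<x_1^n<\dots<x_N^n=\ell$. At node $j$ and layer $n$: $h_j^n=h(x_j^n)$, $\eta_j^n$ is the free surface elevation, $H_j^n=\eta_j^n+h_j^n$ is the total water depth (assumed positive), $v_j^n$ is the (scalar) depth-averaged velocity. The vector of conservative variables and the flux are $$\boldsymbol v_j^n=\begin{pmatrix}H_j^n\\ H_j^n v_j^n\end{pmatrix},\qquad \boldsymbol f_j^n=\begin{pmatrix}H_j^n v_j^n\\ H_j^n (v_j^n)^2+\tfrac g2 (H_j^n)^2\end{pmatrix}.$$ **Discrete notation.** For a scalar or vector grid function $\phi$ (including $H$, $v$, $\eta$, $h$, $\boldsymbol v$): $\phi_{j+1/2}^n=\tfrac12(\phi_j^n+\phi_{j+1}^n)$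 and $\phi_{q,j+1/2}^n=(\phi_{j+1}^n-\phi_j^n)/\Delta q$. Moreover $$x_{t,j}^n=\frac{x_j^{n+1}-x_j^n}{\tau},\quad x_{t,j+1/2}^n=\frac{x_{t,j}^n+x_{t,j+1}^n}{2},\quad J_{j+1/2}^n=\frac{x_{j+1}^n-x_j^n}{\Delta q},\quad J_j^n=\frac{J_{j+1/2}^n+J_{j-1/2}^n}{2}.$$ In products at $j+1/2$ each factor is evaluated separately at $j+1/2$, e.g. $(x_t\boldsymbol v)^n_{j+1/2}=x_{t,j+1/2}^n\,\boldsymbol v_{j+1/2}^n$ and $(Hh_q)^n_{j+1/2}=H_{j+1/2}^n\,h_{q,j+1/2}^n$. **Characteristic quantities at $j+1/2$ (layer $n$).** $$c_{j+1/2}^n=\sqrt{(v_{j+1/2}^n)^2-v_j^n v_{j+1}^n+gH_{j+1/2}^n}>0,\qquad \lambda_{1}=v_{j+1/2}^n-c_{j+1/2}^n,\quad \lambda_2=v_{j+1/2}^n+c_{j+1/2}^n,$$ and, with $c=c_{j+1/2}^n$, $$\mathscr L=\frac1{c^2}\begin{pmatrix}-\lambda_2&1\\-\lambda_1&1\end{pmatrix},\quad \mathscr R=\frac c2\begin{pmatrix}-1&1\\-\lambda_1&\lambda_2\end{pmatrix},\quad \bar{\mathscr D}=\begin{pmatrix}\bar\lambda_1&0\\0&\bar\lambda_2\end{pmatrix},\quad \bar\lambda_k=\lambda_k-x_{t,j+1/2}^n,$$ $$\mathscr P=\mathscr L\,\boldsymbol v_{q,j+1/2}^n,\qquad \mathbf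 G_{j+1/2}^n=\begin{pmatrix}0\\ g\,(Hh_q)_{j+1/2}^n\end{pmatrix},\qquad \mathcal D_{j+1/2}^n=\begin{pmatrix}1+\theta^{1}_{j+1/2}&0\\0&1+\theta^{2}_{j+1/2}\end{pmatrix}.$$ **Scheme parameters $\theta^k$, $k=1,2$.** Put $C_{k,j+1/2}=\frac{\tau}{\Delta q}\frac{|\bar\lambda_k|}{J_{j+1/2}^n}$, $\theta_{0}^k=\frac1{C_{k,j+1/2}}-1$, $s_k=\operatorname{sign}(\bar\lambda_{k})$, $\tilde g^k_{j+1/2}=\big(|\bar\lambda_k|(1-C_k)\tilde p^k\big)_{j+1/2}$, where $$\begin{pmatrix}\tilde p^1\\ \tilde p^2\end{pmatrix}_{j+1/2}=\frac1{(c_{j+1/2}^n)^2}\begin{pmatrix}-c\,\eta_q+H v_q\\ c\,\eta_q+Hv_q\end{pmatrix}_{j+1/2}^n ,$$ and $\xi^k=\tilde g^k_{j+1/2-s_k}/\tilde g^k_{j+1/2}$. Then $\theta^k_{j+1/2}$ equals - $0$ if $|\tilde g^k_{j+1/2}|\le|\tilde g^k_{j+1/2-s_k}|$ and $\tilde g^k_{j+1/2}\,\tilde g^k_{j+1/2-s_k}\ge0$; - $\theta_0^k(1-\xi^k)$ if $|\tilde g^k_{j+1/2}|>|\tilde g^k_{j+1/2-s_k}|$ and $\tilde g^k_{j+1/2}\,\tilde g^k_{j+1/2-s_k}\ge0$; - $\theta_0^k$ if $\tilde g^k_{j+1/2}\,\tilde g^k_{j+1/2-s_k}<0$. **Predictor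 step** (cell centers): $$\hat{\boldsymbol f}_{j+1/2}=\frac{\boldsymbol f_j^n+\boldsymbol f_{j+1}^n}{2}-\frac\tau2\Big[\frac1J\,\mathscr R\,\mathcal D\,\bar{\mathscr D}\,\big(\bar{\mathscr D}\,\mathscr P-\mathscr L\,\mathbf G\big)\Big]_{j+1/2}^n .$$ **Corrector step** (nodes): $$\frac{(J\boldsymbol v)_j^{n+1}-(J\boldsymbol v)_j^n}{\tau}+\frac{\big(\hat{\boldsymbol f}-(x_t\boldsymbol v)^n\big)_{j+1/2}-\big(\hat{\boldsymbol f}-(x_t\boldsymbol v)^n\big)_{j-1/2}}{\Delta q}=\mathbf G_j^*,\qquad \mathbf G_j^*=\begin{pmatrix}0\\ g\,H_j^{n+1/2}h_{q,j}^{n+1/2}\end{pmatrix},$$ $$H_j^{n+1/2}=\frac{H_{j+1}^{n+1}+H_{j-1}^{n+1}+H_{j+1}^n+H_{j-1}^n}{4},\qquad h_{q,j}^{n+1/2}=\frac{h_{j+1}^{n+1}-h_{j-1}^{n+1}+h_{j+1}^n-h_{j-1}^n}{4\Delta q}.$$ The first component (mass) is solved first to get $H_j^{n+1}$, $j=1,\dots,N-1$, which are then used in the second component (momentum) to get $H_j^{n+1}v_j^{n+1}$, hence $v_j^{n+1}$; $\eta_j^{n+1}=H_j^{n+1}-h_j^{n+1}$. The numerical treatment of the boundary nodes is not specified beyond ''appropriate boundary conditions''.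
   Formalization: The unspecified ''appropriate boundary conditions'' are assumed not to disturb a lake at rest: from rest, zero new inner elevations give zero boundary elevations, and if all new elevations and inner velocities vanish, so do the boundary velocities. *)

(* Defs.v *)
From HB Require Import structures.
From mathcomp Require Import all_boot all_order all_algebra.

Set Implicit Arguments.
Unset Strict Implicit.
Unset Printing Implicit Defensive.

Import Order.TTheory GRing.Theory Num.Theory.
Local Open Scope ring_scope.

Definition col2 (R : pzRingType) (a b : R) : 'cV[R]_2 :=
  \col_(i < 2) (if i == 0 then a else b).

Definition mat2 (R : pzRingType) (a b c d : R) : 'M[R]_2 :=
  \matrix_(i < 2, j < 2)
    (if i == 0 then (if j == 0 then a else b) else (if j == 0 then c else d)).

(* Only the values at the nodes j = 0, ..., N of a layer are meaningful. *)
Record layer (R : Type) := Layer {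
  node : nat -> R;
  elev : nat -> R;   (* free surface elevation eta *)
  vel  : nat -> R    (* depth-averaged velocity v *)
}.

Section Scheme.

Context {R : rcfType} (g tau : R) (h : R -> R) (N : nat).

Implicit Types (L : layer R) (phi : nat -> R) (k : 'I_2).

(* A quantity attached to the cell centre j+1/2 is indexed by j; hence the
   index j.-1 stands for j-1/2 when 0 < j. *)

Definition dq : R := 1 / N%:R.

Definition mid phi (j : nat) : R := (phi j + phi j.+1) / 2.
Definition diffq phi (j : nat) : R := (phi j.+1 - phi j) / dq.

Definition bathy L (j : nat) : R := h (node L j).
Definition depth L (j : nat) : R := elev L j + bathy L j.

Definition consv L (j : nat) : 'cV[R]_2 := col2 (depth L j) (depth L j * vel L j).
Definition flux L (j : nat) : 'cV[R]_2 :=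
  col2 (depth L j * vel L j)
       (depth L j * vel L j ^+ 2 + g / 2 * depth L j ^+ 2).

Definition consv_half L (j : nat) : 'cV[R]_2 :=
  2^-1 *: (consv L j + consv L j.+1).
Definition consv_q L (j : nat) : 'cV[R]_2 :=
  dq^-1 *: (consv L j.+1 - consv L j).

Definition xt (L L' : layer R) (j : nat) : R := (node L' j - node L j) / tau.
Definition Jhalf L : nat -> R := diffq (node L).
Definition Jnode L (j : nat) : R := (Jhalf L j + Jhalf L j.-1) / 2.

(* Characteristic quantities. The families indexed by k = 1, 2 are indexed here
   by 'I_2, so that k = 1 becomes 0 and k = 2 becomes 1. *)

Definition speed L (j : nat) : R :=
  Num.sqrt (mid (vel L) j ^+ 2 - vel L j * vel L j.+1 + g * mid (depth L) j).

Definition lam L k (j : nat) : R :=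
  if k == 0 then mid (vel L) j - speed L j else mid (vel L) j + speed L j.

Definition lambar (L L' : layer R) k (j : nat) : R := lam L k j - mid (xt L L') j.

Definition Lmx L (j : nat) : 'M[R]_2 :=
  (1 / speed L j ^+ 2) *: mat2 (- lam L 1 j) 1
                               (- lam L 0 j) 1.

Definition Rmx L (j : nat) : 'M[R]_2 :=
  (speed L j / 2) *: mat2 (- 1)          1
                          (- lam L 0 j)  (lam L 1 j).

Definition Dbar (L L' : layer R) (j : nat) : 'M[R]_2 := diag_mx (\row_k lambar L L' k j).

Definition Pvec L (j : nat) : 'cV[R]_2 := Lmx L j *m consv_q L j.

Definition Gvec L (j : nat) : 'cV[R]_2 :=
  col2 0 (g * (mid (depth L) j * diffq (bathy L) j)).

Definition Dtheta (theta : 'I_2 -> nat -> R) (j : nat) : 'M[R]_2 :=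
  diag_mx (\row_k (1 + theta k j)).

Definition courant (L L' : layer R) k (j : nat) : R :=
  tau / dq * (`|lambar L L' k j| / Jhalf L j).

Definition theta0 (L L' : layer R) k (j : nat) : R := 1 / courant L L' k j - 1.

Definition ptilde L (j : nat) : 'cV[R]_2 :=
  (1 / speed L j ^+ 2) *:
    col2 (- (speed L j * diffq (elev L) j) + mid (depth L) j * diffq (vel L) j)
         (speed L j * diffq (elev L) j + mid (depth L) j * diffq (vel L) j).

Definition gtilde (L L' : layer R) k (j : nat) : R :=
  `|lambar L L' k j| * (1 - courant L L' k j) * ptilde L j k 0.

(* [i] is the upwind cell, i + 1/2 = j + 1/2 - s_k. *)
Definition theta_val (L L' : layer R) k (j i : nat) : R :=
  let gj := gtilde L L' k j in
  let gi := gtilde L L' k i in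
  if gj * gi < 0 then theta0 L L' k j
  else if `|gj| <= `|gi| then 0
  else theta0 L L' k j * (1 - gi / gj).

(* In a boundary cell whose upwind neighbour lies outside the grid the rule
   above does not apply, and theta is left arbitrary there. *)
Definition is_theta (L L' : layer R) (theta : 'I_2 -> nat -> R) : Prop :=
  forall k (j i : nat), (j < N)%N -> (i < N)%N ->
    i%:Z = j%:Z - sgz (lambar L L' k j) ->
    theta k j = theta_val L L' k j i.

Definition predictor (L L' : layer R) theta (j : nat) : 'cV[R]_2 :=
  2^-1 *: (flux L j + flux L j.+1)
  - (tau / 2) *: ((1 / Jhalf L j) *:
      (Rmx L j *m Dtheta theta j *m Dbar L L' j *m
         (Dbar L L' j *m Pvec L j - Lmx L j *m Gvec L j))).

Definition relflux (L L' : layer R) theta (j : nat) : 'cV[R]_2 :=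
  predictor L L' theta j - mid (xt L L') j *: consv_half L j.

Definition depth_mid (L L' : layer R) (j : nat) : R :=
  (depth L' j.+1 + depth L' j.-1 + depth L j.+1 + depth L j.-1) / 4.

Definition bathy_q_mid (L L' : layer R) (j : nat) : R :=
  (bathy L' j.+1 - bathy L' j.-1 + bathy L j.+1 - bathy L j.-1) / (4 * dq).

Definition Gstar (L L' : layer R) (j : nat) : 'cV[R]_2 :=
  col2 0 (g * depth_mid L L' j * bathy_q_mid L L' j).

Definition corrector (L L' : layer R) theta : Prop :=
  forall j : nat, (0 < j < N)%N ->
    tau^-1 *: (Jnode L' j *: consv L' j - Jnode L j *: consv L j)
    + dq^-1 *: (relflux L L' theta j - relflux L L' theta j.-1)
    = Gstar L L' j.

(* [BC L L'] is the numerical treatment of the two boundary nodes. *)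
Definition scheme_step (BC : layer R -> layer R -> Prop) (L L' : layer R) : Prop :=
  exists theta : 'I_2 -> nat -> R,
    [/\ is_theta L L' theta, corrector L L' theta & BC L L'].

Definition is_grid (l : R) L : Prop :=
  [/\ node L 0 = 0, node L N = l &
      forall j : nat, (j < N)%N -> node L j < node L j.+1].

Definition positive_depth L : Prop :=
  forall j : nat, (j <= N)%N -> 0 < depth L j.

Definition fixed_grid (L L' : layer R) : Prop :=
  forall j : nat, (j <= N)%N -> node L' j = node L j.

Definition lake_at_rest L : Prop :=
  forall j : nat, (j <= N)%N -> elev L j = 0 /\ vel L j = 0.

(* Minimal requirement on the boundary treatment: it must not by itself disturb
   a lake at rest. It follows the order of the computation (the mass equation
   gives the inner depths, the boundary depths are then set, the momentum
   equation gives the inner velocities, the boundary velocities are then set),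
   so that the boundary values may depend on the inner values of the new layer,
   as for wall conditions or extrapolation. *)
Definition rest_compatible (l : R) (BC : layer R -> layer R -> Prop) : Prop :=
  forall L L' : layer R, is_grid l L -> positive_depth L -> fixed_grid L L' ->
    lake_at_rest L -> BC L L' ->
    ((forall j : nat, (0 < j < N)%N -> elev L' j = 0) ->
       elev L' 0 = 0 /\ elev L' N = 0)
    /\
    ((forall j : nat, (j <= N)%N -> elev L' j = 0) ->
     (forall j : nat, (0 < j < N)%N -> vel L' j = 0) ->
       vel L' 0 = 0 /\ vel L' N = 0).

End Scheme.

(* Main.v *)
Require Import Defs.
From HB Require Import structures.
From mathcomp Require Import all_boot all_order all_algebra.
From mathcomp Require Import ring.

Import Order.TTheory GRing.Theory Num.Theory.
Local Open Scope ring_scope.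

(** The scheme is well balanced because both of its discretizations of the
    pressure gradient cancel the bathymetry source exactly when [H = h] and
    [v = 0].

    In the predictor, [c ^ 2 = g H_{j+1/2}] and the characteristic speeds on a
    fixed grid are [-c] and [c]; then [Dbar P] and [L G] both have all their
    components equal to [h_q], so that the whole stabilizing term vanishes
    ([characteristic_balance_rest]).  The intermediate flux is therefore the mean
    of the two nodal pressures.

    In the corrector, the mass flux vanishes, so the depth does not change at
    the inner nodes.  The boundary treatment then keeps the boundary elevation,
    and all depths needed by the momentum source are known to equal [h].  With
    these depths, the factorization
    [h_{j+1}^2 - h_{j-1}^2 = (h_{j+1} + h_{j-1}) (h_{j+1} - h_{j-1})]
    identifies the difference of the mean pressures with the source, which
    leaves [H v = 0] on the new layer, and [H > 0] gives [v = 0]. *)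

Section PlaneMatrices.

Context {R : comPzRingType}.
Implicit Types a b c d x y : R.

Lemma col2_0 a b : col2 a b 0 0 = a.
Proof. by rewrite mxE. Qed.

Lemma col2_1 a b : col2 a b 1 0 = b.
Proof. by rewrite mxE. Qed.

Lemma col2D a b c d : col2 a b + col2 c d = col2 (a + c) (b + d).
Proof. by apply/matrixP=> i j; rewrite !mxE; case: ifP. Qed.

Lemma col2N a b : - col2 a b = col2 (- a) (- b).
Proof. by apply/matrixP=> i j; rewrite !mxE; case: ifP. Qed.

Lemma col2Z a b c : a *: col2 b c = col2 (a * b) (a * c).
Proof. by apply/matrixP=> i j; rewrite !mxE; case: ifP. Qed.

Lemma mul_mat2_col2 a b c d x y :
  mat2 a b c d *m col2 x y = col2 (a * x + b * y) (c * x + d * y).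
Proof.
apply/matrixP=> i j; rewrite !mxE !big_ord_recl big_ord0 !mxE /= addr0.
by case: ifP.
Qed.

Lemma mul_diag_mx_col2 (f : 'I_2 -> R) x y :
  diag_mx (\row_k f k) *m col2 x y = col2 (f 0 * x) (f 1 * y).
Proof.
apply/matrixP=> i j; rewrite mul_diag_mx !mxE.
by case: i => [[|[|i]] hi] //=; congr (f _ * _); apply/val_inj.
Qed.

End PlaneMatrices.

Section LakeAtRest.

Set Implicit Arguments.
Unset Strict Implicit.

Context {R : rcfType} {g l tau : R} {N : nat} {h : R -> R}.
Context {L L' : layer R} {theta : 'I_2 -> nat -> R}.
Hypotheses (g_gt0 : 0 < g) (tau_gt0 : 0 < tau).
Hypotheses (grid : is_grid N l L) (depth_gt0 : positive_depth h N L).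
Hypotheses (fixed : fixed_grid N L L') (rest : lake_at_rest N L).

Local Notation bathy := (bathy h).
Local Notation depth := (depth h).

Lemma dq_gt0 : (0 < N)%N -> 0 < dq N :> R.
Proof. by move=> N_gt0; rewrite divr_gt0 ?ltr0n. Qed.

Lemma depth_rest j : (j <= N)%N -> depth L j = bathy L j.
Proof. by move=> /rest[e0 _]; rewrite /depth e0 add0r. Qed.

Lemma bathy_fixed j : (j <= N)%N -> bathy L' j = bathy L j.
Proof. by move=> jN; rewrite /bathy fixed. Qed.

Lemma mid_xt_fixed j : (j < N)%N -> mid (xt tau L L') j = 0.
Proof.
by move=> jN; rewrite /mid /xt !fixed // 1?ltnW // !subrr !mul0r addr0 mul0r.
Qed.

Lemma Jhalf_gt0 j : (j < N)%N -> 0 < Jhalf N L j.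
Proof.
move=> jN; case: grid => _ _ incr.
by rewrite divr_gt0 ?subr_gt0 ?incr ?dq_gt0 ?(leq_trans _ jN).
Qed.

Lemma Jnode_gt0 j : (0 < j < N)%N -> 0 < Jnode N L j.
Proof.
move=> /andP[j0 jN]; rewrite divr_gt0 ?addr_gt0 ?Jhalf_gt0 //.
exact: leq_ltn_trans (leq_pred j) jN.
Qed.

Lemma Jnode_tau_neq0 j : (0 < j < N)%N -> Jnode N L j / tau != 0.
Proof. by move=> j_in; rewrite gt_eqF // divr_gt0 // Jnode_gt0. Qed.

Lemma Jnode_fixed j : (0 < j < N)%N -> Jnode N L' j = Jnode N L j.
Proof.
case: j => // j /= jN.
by rewrite /Jnode /Jhalf /diffq /= !fixed // 1?ltnW // 1?ltnW.
Qed.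

Lemma mid_vel_rest j : (j < N)%N -> mid (vel L) j = 0.
Proof.
move=> jN; have [_ v0] := rest (ltnW jN); have [_ v1] := rest jN.
by rewrite /mid v0 v1 addr0 mul0r.
Qed.

Lemma mid_depth_gt0 j : (j < N)%N -> 0 < mid (depth L) j.
Proof.
move=> jN; rewrite divr_gt0 //.
by apply: addr_gt0; apply: depth_gt0; rewrite // ltnW.
Qed.

Lemma sqr_speed_rest j : (j < N)%N ->
  speed g h L j ^+ 2 = g * mid (depth L) j.
Proof.
move=> jN; have [_ v0] := rest (ltnW jN).
rewrite /speed mid_vel_rest // v0 mul0r expr0n subrr add0r sqr_sqrtr //.
by rewrite ltW // mulr_gt0 ?mid_depth_gt0.
Qed.

Lemma speed_rest_neq0 j : (j < N)%N -> speed g h L j != 0.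
Proof.
move=> jN; rewrite -sqrf_eq0 sqr_speed_rest // gt_eqF //.
by rewrite mulr_gt0 ?mid_depth_gt0.
Qed.

Lemma consv_q_rest j : (j < N)%N -> consv_q h N L j = col2 (diffq N (bathy L) j) 0.
Proof.
move=> jN; have [_ v0] := rest (ltnW jN); have [_ v1] := rest jN.
rewrite /consv_q /consv v0 v1 !mulr0 col2N col2D col2Z subrr mulr0.
by rewrite /diffq !depth_rest // 1?ltnW // mulrC.
Qed.

(** In the basis of eigenvectors, the advected jump of the state and the source
    are the same vector, with both components equal to [h_q]: the former
    because the advection speeds [-c] and [c] compensate the opposite signs of
    the two components of [P], the latter because [g H = c ^ 2]. *)
Lemma characteristic_balance_rest j : (j < N)%N ->
  Dbar g tau h L L' j *m Pvec g h N L j = Lmx g h L j *m Gvec g h N L j.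
Proof.
move=> jN; have c_neq0 := speed_rest_neq0 jN.
rewrite /Pvec /Gvec /Lmx consv_q_rest // mulrA -sqr_speed_rest //.
rewrite -!scalemxAl !mul_mat2_col2 !col2Z mul_diag_mx_col2.
rewrite /lambar mid_xt_fixed // /lam /= mid_vel_rest //.
by congr col2; field.
Qed.

Lemma predictor_rest j : (j < N)%N ->
  predictor g tau h N L L' theta j
  = col2 0 (g / 4 * (bathy L j ^+ 2 + bathy L j.+1 ^+ 2)).
Proof.
move=> jN; have [_ v0] := rest (ltnW jN); have [_ v1] := rest jN.
rewrite /predictor characteristic_balance_rest // subrr mulmx0 !scaler0 subr0.
rewrite /flux v0 v1 !depth_rest // 1?ltnW // col2D col2Z.
by congr col2; field.
Qed.

Lemma relflux_rest j : (j < N)%N ->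
  relflux g tau h N L L' theta j
  = col2 0 (g / 4 * (bathy L j ^+ 2 + bathy L j.+1 ^+ 2)).
Proof.
by move=> jN; rewrite /relflux mid_xt_fixed // scale0r subr0 predictor_rest.
Qed.

Hypothesis corr : corrector g tau h N L L' theta.

(** The pressures at node [j] are shared by both cells, hence the differences
    over two cells in the momentum component. *)
Lemma corrector_rest j : (0 < j < N)%N ->
  Jnode N L j / tau * (depth L' j - bathy L j) = 0 /\
  Jnode N L j / tau * (depth L' j * vel L' j)
  + g / 4 / dq N * (bathy L j.+1 ^+ 2 - bathy L j.-1 ^+ 2)
  = g * depth_mid h L L' j * bathy_q_mid h N L L' j.
Proof.
move=> j_in; have := corr j_in; case/andP: (j_in) => j0 jN.
have pjN : (j.-1 < N)%N by exact: leq_ltn_trans (leq_pred j) jN.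
have [_ v0] := rest (ltnW jN).
rewrite !relflux_rest // Jnode_fixed // prednK // /consv /Gstar v0 mulr0.
rewrite depth_rest // 1?ltnW // !(col2N, col2D, col2Z) => E; split.
  by have := congr1 (fun M : 'cV_2 => M 0 0) E; rewrite !col2_0 => <-; ring.
by have := congr1 (fun M : 'cV_2 => M 1 0) E; rewrite !col2_1 => <-; ring.
Qed.

Lemma depth_next_rest j : (0 < j < N)%N -> depth L' j = bathy L j.
Proof.
move=> j_in; have [/eqP + _] := corrector_rest j_in.
rewrite mulf_eq0 (negPf (Jnode_tau_neq0 j_in)) /=.
by rewrite subr_eq0 => /eqP.
Qed.

Lemma elev_next_rest j : (0 < j < N)%N -> elev L' j = 0.
Proof.
move=> j_in; have := depth_next_rest j_in; case/andP: j_in => _ jN.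
by rewrite /depth bathy_fixed // 1?ltnW // => /eqP; rewrite -subr_eq0 addrK => /eqP.
Qed.

(** The elevation is required at the boundary nodes too, because the momentum
    source at the first and last inner nodes involves the new boundary depths. *)
Lemma vel_next_rest j : (forall i, (i <= N)%N -> elev L' i = 0) ->
  (0 < j < N)%N -> vel L' j = 0.
Proof.
move=> e0 j_in; have [_] := corrector_rest j_in.
case/andP: (j_in) => j0 jN.
have pjN : (j.-1 <= N)%N by exact: leq_trans (leq_pred j) (ltnW jN).
have dq_neq0 : dq N != 0 :> R by rewrite gt_eqF ?dq_gt0 ?(leq_trans _ jN).
have depth' i : (i <= N)%N -> depth L' i = bathy L i.
  by move=> iN; rewrite /depth e0 // add0r bathy_fixed.
rewrite /depth_mid /bathy_q_mid !depth' ?(ltnW jN) // !depth_rest //.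
rewrite !bathy_fixed //.
set a := bathy L j.+1; set b := bathy L j.-1 => E.
have : Jnode N L j / tau * (bathy L j * vel L' j) = 0.
  apply: (addIr (g / 4 / dq N * (a ^+ 2 - b ^+ 2))).
  (* The source is [g ((a + b) / 2) ((a - b) / (2 dq))]. *)
  by rewrite E; field.
have H_gt0 : 0 < bathy L j by rewrite -depth_rest // 1?ltnW // depth_gt0 // ltnW.
move=> /eqP; rewrite mulf_eq0 (negPf (Jnode_tau_neq0 j_in)) /=.
by rewrite mulf_eq0 (gt_eqF H_gt0) => /eqP.
Qed.

End LakeAtRest.

Lemma inner_or_boundary {N : nat} {P : nat -> Prop} :
  P 0%N -> P N -> (forall j, (0 < j < N)%N -> P j) ->
  forall j, (j <= N)%N -> P j.
Proof.
move=> P0 PN Pin [//|j]; rewrite leq_eqVlt => /orP[/eqP->//|jN].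
exact: Pin.
Qed.

Theorem theorem1 (R : rcfType) (g l tau : R) (N : nat) (h : R -> R)
    (BC : layer R -> layer R -> Prop) (U : nat -> layer R) (n : nat)
    (g_gt0 : 0 < g) (l_gt0 : 0 < l) (tau_gt0 : 0 < tau) (N_gt0 : (0 < N)%N)
    (grid : forall m : nat, is_grid N l (U m))
    (depth_gt0 : positive_depth h N (U n))
    (bc_rest : rest_compatible h N l BC)
    (step : scheme_step g tau h N BC (U n) (U n.+1))
    (fixed : fixed_grid N (U n) (U n.+1))
    (rest : lake_at_rest N (U n)) :
  lake_at_rest N (U n.+1).
Proof.
case: step => theta [_ corr bc].
have [bc_elev bc_vel] := bc_rest _ _ (grid n) depth_gt0 fixed rest bc.
have elev_in j : (0 < j < N)%N -> elev (U n.+1) j = 0.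
  exact: (elev_next_rest g_gt0 tau_gt0 (grid n) depth_gt0 fixed rest corr).
have [elev0 elevN] := bc_elev elev_in.
have elev' : forall j, (j <= N)%N -> elev (U n.+1) j = 0.
  exact: inner_or_boundary.
have vel_in j : (0 < j < N)%N -> vel (U n.+1) j = 0.
  exact: (vel_next_rest g_gt0 tau_gt0 (grid n) depth_gt0 fixed rest corr).
have [vel0 velN] := bc_vel elev' vel_in.
have vel' : forall j, (j <= N)%N -> vel (U n.+1) j = 0.
  exact: inner_or_boundary.
by move=> j jN; split; [exact: elev' | exact: vel'].
Qed.
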